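(* Let $(\Omega, \mathcal F, (\mathcal F_t)_{t \geq 0}, \mathsf P)$ be a filtered probability space with $\bigcup_{t \geq 0} \mathcal F_t \subset \mathcal F$. Let $N \in \mathbb{N}_0 = \{0,1,2,\dots\}$ and let $0 \leq \rho_1 \leq \cdots \leq \rho_N$ be stopping times (with values in $[0,\infty]$). For each $m = 1, \dots, N$ let $J_m$ be an $\mathcal F_{\rho_m}$-measurable random variable. Suppose that the process $M = (M_t)_{t\ge 0}$ given by \[ M_t = \sum_{m=1}^N J_m \mathbf{1}_{\{t \geq \rho_m\}}, \qquad t \geq 0, \] is a local martingale. If \[ \mathsf E\Big[\liminf_{t \uparrow \infty} M_t^-\Big] < \infty, \] then $M$ is a uniformly integrable martingale.
   Context: $x^- = \max(-x,0)$ denotes the negative part. A local martingale is an adapted process $M$ for which there is a nondecreasing sequence of stopping times $\tau_n \uparrow \infty$ such that each stopped process $M^{\tau_n} = (M_{t \wedge \tau_n})_{t\ge0}$ is a uniformly integrable martingale. The empty sum (case $N=0$) is $M \equiv 0$. *)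

(* Defs.v *)
From HB Require Import structures.
From mathcomp Require Import all_boot all_order all_algebra.
From mathcomp Require Import all_classical all_reals all_analysis.
Set Implicit Arguments. Unset Strict Implicit. Unset Printing Implicit Defensive.
Import Order.TTheory GRing.Theory Num.Theory.
Local Open Scope classical_set_scope.
Local Open Scope ring_scope.
Local Open Scope ereal_scope.

Section Defs.
Context (d : measure_display) (Omega : measurableType d) (R : realType).
Implicit Types (F : R -> set (set Omega)) (P : probability Omega R).

Definition filtration F :=
  [/\ (forall t, (0 <= t)%R -> sigma_algebra setT (F t)),
      (forall t, (0 <= t)%R -> F t `<=` measurable) &
      (forall s t, (0 <= s)%R -> (s <= t)%R -> F s `<=` F t)].

Definition stopping_time F (rho : Omega -> \bar R) :=
  (forall w, 0 <= rho w) /\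
  (forall t, (0 <= t)%R -> F t [set w | rho w <= t%:E]).

Definition F_at F (rho : Omega -> \bar R) : set (set Omega) :=
  [set A | measurable A /\
     forall t, (0 <= t)%R -> F t (A `&` [set w | rho w <= t%:E])].

Definition measurable_wrt (G : set (set Omega)) (X : Omega -> R) :=
  forall B : set R, measurable B -> G (X @^-1` B).

Definition adapted F (X : R -> Omega -> R) :=
  forall t, (0 <= t)%R -> measurable_wrt (F t) (X t).

(* martingale: adapted, integrable, and E[X_t | F_s] = X_s for s <= t,
   i.e. E[X_t 1_A] = E[X_s 1_A] for all A in F_s *)
Definition martingale F P (X : R -> Omega -> R) :=
  [/\ adapted F X,
      (forall t, (0 <= t)%R -> P.-integrable setT (EFin \o X t)) &
      (forall s t A, (0 <= s)%R -> (s <= t)%R -> F s A ->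
         \int[P]_(w in A) (X t w)%:E = \int[P]_(w in A) (X s w)%:E)].

Definition unif_integrable P (X : R -> Omega -> R) :=
  forall e : R, (0 < e)%R -> exists K : R, forall t, (0 <= t)%R ->
    \int[P]_(w in [set w | (K < `|X t w|)%R]) (`|X t w|)%:E < e%:E.

Definition UI_martingale F P X := martingale F P X /\ unif_integrable P X.

Definition stopped (X : R -> Omega -> R) (tau : Omega -> \bar R) :
  R -> Omega -> R := fun t w => X (fine (mine t%:E (tau w))) w.

Definition local_martingale F P (X : R -> Omega -> R) :=
  exists tau : nat -> Omega -> \bar R,
    [/\ (forall n, stopping_time F (tau n)),
        (forall n w, tau n w <= tau n.+1 w),
        (forall w, tau ^~ w @ \oo --> +oo) &
        (forall n, UI_martingale F P (stopped X (tau n)))].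

Definition liminf_pinfty (f : R -> \bar R) : \bar R :=
  ereal_sup [set ereal_inf [set f t | t in [set t | (s <= t)%R]]
            | s in [set s | (0 <= s)%R]].

Definition negpart (x : R) : R := Num.max (- x)%R 0%R.
End Defs.

(* Main.v *)
Require Import Defs.
From HB Require Import structures.
From mathcomp Require Import all_boot all_order all_algebra.
From mathcomp Require Import all_classical all_reals all_analysis.
From mathcomp Require Import measurable_realfun lra.
Import Order.TTheory GRing.Theory Num.Theory.
Local Open Scope classical_set_scope.
Local Open Scope ring_scope.
Local Open Scope ereal_scope.

(** Extend [M] to time [+oo] by its final value and let [V k] be its value at the
    [k]-th jump time, with [V 0 = M 0].  On the event that the [k.+1]-st jump
    happens before the localizing time, optional stopping gives
    [E[V k.+1 | F_k] = V k], because [M] is constant between consecutive jumps.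
    Hence the negative part of [V k.+1] controls that of [V k]: starting from the
    final value, whose negative part is integrable by hypothesis, every [V k] has
    an integrable negative part.  Going forward from [V 0], which is integrable,
    the same identity then shows that every [V k] is integrable.  So [|M|] is
    dominated by the integrable variable [|V 0| + ... + |V N|], and dominated
    convergence turns the local martingale into a uniformly integrable one. *)

Set Implicit Arguments.
Unset Strict Implicit.
Unset Printing Implicit Defensive.

(** * Events and stopping times of a filtration *)

Section FiltrationSets.
Context {d : measure_display} {Omega : measurableType d} {R : realType}.
Implicit Types (F : R -> set (set Omega)) (G : set (set Omega))
  (a b : Omega -> \bar R).

Lemma sigma_algebra_measurableE G (A : set Omega) :
  sigma_algebra setT G ->
  G A <-> measurable (A : set (g_sigma_algebraType G)).
Proof. by move=> sG; rewrite /measurable/= sigma_algebra_id. Qed.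

Lemma measurable_wrtP G (X : Omega -> R) : sigma_algebra setT G ->
  measurable_wrt G X <->
  measurable_fun [set: g_sigma_algebraType G] (X : g_sigma_algebraType G -> R).
Proof.
move=> sG; split=> [mX _ B mB|mX B mB].
  by rewrite setTI; apply/(sigma_algebra_measurableE _ sG); exact: mX.
apply/(sigma_algebra_measurableE _ sG).
by have := mX measurableT _ mB; rewrite setTI.
Qed.

(** Inside [{a <= t}] the complementary event is [{b < a}]; a rational time separates [b] from [a],
    so this is a countable union of events decided by time [t]. *)
Lemma stopping_time_le F a b (t : R) : filtration F ->
  stopping_time F a -> stopping_time F b -> (0 <= t)%R ->
  F t ([set w | a w <= b w] `&` [set w | a w <= t%:E]).
Proof.
move=> [sF _ mono] [a0 sa] [b0 sb] t0.
(* Rationals are clamped to [[0, t]]: the filtration axioms concern nonnegative times, and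
   monotonicity then carries [F (q r)] into [F t]. *)
pose q (r : rat) : R := Num.max 0%R (Num.min (ratr r) t).
have q0 r : (0 <= q r)%R by rewrite le_max lexx.
have qt r : (q r <= t)%R by rewrite ge_max t0/= ge_min lexx orbT.
have -> : [set w | a w <= b w] `&` [set w | a w <= t%:E] =
    [set w | a w <= t%:E] `\`
    \bigcup_r ([set w | b w <= (q r)%:E] `\` [set w | a w <= (q r)%:E]).
  apply/seteqP; split=> w /= [].
    move=> ab at_; split=> // -[r _ [/= bq aq]].
    by apply: aq; exact: le_trans ab bq.
  move=> at_ nE; split=> //; rewrite leNgt; apply/negP => ba; apply: nE.
  have afin : a w \is a fin_num.
    by rewrite ge0_fin_numE//; exact: le_lt_trans at_ (ltry _).
  have bfin : b w \is a fin_num.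
    by rewrite ge0_fin_numE//; exact: lt_trans ba (le_lt_trans at_ (ltry _)).
  have b0w := b0 w.
  rewrite -(fineK afin) -(fineK bfin) lte_fin in ba.
  rewrite -(fineK afin) lee_fin in at_.
  rewrite -(fineK bfin) lee_fin in b0w.
  have [r] := rat_in_itvoo ba; rewrite in_itv/= => /andP[br ra].
  have qr : q r = ratr r :> R.
    rewrite /q min_l; last lra.
    by rewrite max_r//; lra.
  exists r => //; split => /=; rewrite qr.
    by rewrite -(fineK bfin) lee_fin; lra.
  by rewrite -(fineK afin) lee_fin; lra.
apply/(sigma_algebra_measurableE _ (sF _ t0)); apply: measurableD.
  by apply/(sigma_algebra_measurableE _ (sF _ t0)); exact: sa.
apply: bigcupT_measurable_rat => r; apply: measurableD;
  apply/(sigma_algebra_measurableE _ (sF _ t0)).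
- by apply: (mono (q r)) => //; exact: sb.
- by apply: (mono (q r)) => //; exact: sa.
Qed.

Lemma filtration_setI F (t : R) (A B : set Omega) : filtration F -> (0 <= t)%R ->
  F t A -> F t B -> F t (A `&` B).
Proof.
move=> [sF _ _] t0 FA FB; apply/(sigma_algebra_measurableE _ (sF _ t0)).
by apply: measurableI; apply/(sigma_algebra_measurableE _ (sF _ t0)).
Qed.

Lemma filtration_setD F (t : R) (A B : set Omega) : filtration F -> (0 <= t)%R ->
  F t A -> F t B -> F t (A `\` B).
Proof.
move=> [sF _ _] t0 FA FB; apply/(sigma_algebra_measurableE _ (sF _ t0)).
by apply: measurableD; apply/(sigma_algebra_measurableE _ (sF _ t0)).
Qed.

Lemma filtration_setT F (t : R) : filtration F -> (0 <= t)%R -> F t setT.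
Proof.
move=> [sF _ _] t0; apply/(sigma_algebra_measurableE _ (sF _ t0)).
exact: measurableT.
Qed.

Lemma stopping_time_min_cst F a (T : R) : filtration F -> (0 <= T)%R ->
  stopping_time F a -> stopping_time F (fun w => mine (a w) T%:E).
Proof.
move=> hF T0 [a0 sa]; split=> [w|t t0]; first by rewrite le_min a0 lee_fin.
have [Tt|tT] := leP T t.
  rewrite (_ : mkset _ = setT); first exact: filtration_setT.
  by apply/seteqP; split=> w //= _; rewrite ge_min lee_fin Tt orbT.
rewrite (_ : mkset _ = [set w | a w <= t%:E]); first exact: sa.
by apply/seteqP; split=> w /=; rewrite ge_min lee_fin (leNgt T) tT orbF.
Qed.

Lemma stopping_time_cst F (T : R) : filtration F -> (0 <= T)%R ->
  stopping_time F (cst T%:E).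
Proof.
move=> hF T0; split=> [w|t t0]; first by rewrite lee_fin.
have [Tt|tT] := leP T t.
  rewrite (_ : mkset _ = setT); first exact: filtration_setT.
  by apply/seteqP; split=> w //= _; rewrite lee_fin.
rewrite (_ : mkset _ = setT `\` setT).
  by apply: filtration_setD => //; exact: filtration_setT.
by rewrite setDv; apply/seteqP; split=> w //=; rewrite lee_fin (leNgt T) tT.
Qed.

Lemma stopping_time_pinfty F : filtration F -> stopping_time F (cst +oo).
Proof.
move=> hF; split=> [w|t t0]; first exact: leey.
have -> : [set w | cst +oo w <= t%:E] = setT `\` setT :> set Omega.
  by rewrite setDv; apply/seteqP; split.
by apply: filtration_setD => //; exact: filtration_setT.
Qed.

End FiltrationSets.

(** * Integrals along increasing and truncated domains *)

Section TruncatedIntegral.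
Context {d : measure_display} {Omega : measurableType d} {R : realType}.
Context (mu : {measure set Omega -> \bar R}).

Lemma nondecreasing_integral_le (D : nat -> set Omega) (f : Omega -> \bar R)
    (C : \bar R) :
  {homo D : n m / (n <= m)%N >-> n `<=` m} ->
  (forall n, measurable (D n)) -> measurable_fun (\bigcup_n D n) f ->
  (forall w, 0 <= f w) ->
  (forall n, \int[mu]_(w in D n) f w <= C) ->
  \int[mu]_(w in \bigcup_n D n) f w <= C.
Proof.
move=> homoD mD mf f0 fC.
have mfn n : measurable_fun (D n) f by exact: (measurable_fun_bigcup _ mD).1.
have := @ge0_nondecreasing_set_cvg_integral _ _ _ D f mu.
move=> /(_ _ mD mfn (fun i x _ => f0 x)) cvgf.
have {}cvgf := cvgf (fun n m nm => introT (subsetPset _ _) (homoD n m nm)).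
rewrite -(cvg_lim _ cvgf)//; apply: lime_le; first by apply/cvg_ex; eexists; exact: cvgf.
by near=> n; exact: fC.
Unshelve. all: by end_near. Qed.

(* Agreement on the bounded pieces of [Z] makes [W] act as a conditional
   expectation: [Z >= 0] and [Z < 0] give [|Z|] an integral below that of [|W|]. *)
Lemma truncated_integral (A : set Omega) (Z W : Omega -> R) : measurable A ->
  measurable_fun A Z -> mu.-integrable A (EFin \o W) ->
  (forall (S : set R) (K : R), measurable S ->
    (forall x, S x -> (`|x| <= K)%R) ->
    \int[mu]_(w in A `&` Z @^-1` S) (Z w)%:E =
    \int[mu]_(w in A `&` Z @^-1` S) (W w)%:E) ->
  mu.-integrable A (EFin \o Z) /\
  \int[mu]_(w in A) (Z w)%:E = \int[mu]_(w in A) (W w)%:E.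
Proof.
move=> mA mZ iW ZW.
have mAS S : measurable S -> measurable (A `&` Z @^-1` S) by exact: mZ.
pose B k := A `&` Z @^-1` `[(- k%:R)%R, k%:R].
have mB k : measurable (B k) by exact: mAS.
have homoB : {homo B : n m / (n <= m)%N >-> n `<=` m}.
  move=> n m nm w [Aw /=]; rewrite !in_itv/= => /andP[h1 h2]; split=> //=.
  rewrite in_itv/= (le_trans _ h1) ?lerN2 ?ler_nat//=.
  by rewrite (le_trans h2) ?ler_nat.
have cupB : \bigcup_k B k = A.
  apply/seteqP; split=> [w [k _ []]//|w Aw].
  exists (Num.truncn `|Z w|).+1 => //; split=> //=.
  rewrite in_itv/= -ler_norml; apply/ltW; exact: truncnS_gt.
have mW : measurable_fun A W by apply/measurable_EFinP; case/integrableP: iW.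
have mnZ : measurable_fun A (fun w => `|Z w|%:E).
  by apply/measurable_EFinP; exact: measurableT_comp.
have mnW : measurable_fun A (fun w => `|W w|%:E).
  by apply/measurable_EFinP; exact: measurableT_comp.
(* Where [Z] has constant sign, the integral of [|Z|] is the absolute value of that of [Z], which is
   that of [W]. *)
have ZleW (S : set R) K : measurable S -> (forall x, S x -> (`|x| <= K)%R) ->
    (forall x, S x -> (0 <= x)%R) \/ (forall x, S x -> (x <= 0)%R) ->
    \int[mu]_(w in A `&` Z @^-1` S) `|Z w|%:E <=
    \int[mu]_(w in A `&` Z @^-1` S) `|W w|%:E.
  move=> mS SK sgn.
  have -> : \int[mu]_(w in A `&` Z @^-1` S) `|Z w|%:E =
      `|\int[mu]_(w in A `&` Z @^-1` S) (Z w)%:E|.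
    case: sgn => sgn.
      rewrite gee0_abs; last by apply: integral_ge0 => w [_ /sgn]; rewrite lee_fin.
      by apply: eq_integral => w; rewrite inE => -[_ /sgn] /ger0_norm ->.
    have -> : \int[mu]_(w in A `&` Z @^-1` S) (Z w)%:E =
        \int[mu]_(w in A `&` Z @^-1` S) (- `|Z w|%:E).
      apply: eq_integral => w; rewrite inE => -[_ /sgn] /ler0_norm ->.
      by rewrite EFinN oppeK.
    rewrite integral_ge0N; last by move=> w _; rewrite lee_fin.
    by rewrite abseN gee0_abs//; apply: integral_ge0 => w _; rewrite lee_fin.
  rewrite (ZW _ _ mS SK); apply: le_abse_integral; first exact: mAS.
  by apply/measurable_EFinP; exact: measurable_funS mW.
have bnd k : \int[mu]_(w in B k) `|Z w|%:E <= \int[mu]_(w in A) `|W w|%:E.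
  pose S1 := `[0%R, k%:R : R]%classic; pose S2 := `[(- k%:R)%R : R, 0%R[%classic.
  have BE : B k = (A `&` Z @^-1` S1) `|` (A `&` Z @^-1` S2).
    rewrite -setIUr; congr (_ `&` _); apply/seteqP; split=> w /=;
      rewrite /S1 /S2/= !in_itv/=.
      by move=> /andP[? ?]; case: (leP 0%R (Z w)) => ?; [left|right]; apply/andP.
    have k0 : (0 <= k%:R :> R)%R by rewrite ler0n.
    by move=> [] /andP[? ?]; apply/andP; split; lra.
  have mS1 : measurable S1 by exact: measurable_itv.
  have mS2 : measurable S2 by exact: measurable_itv.
  have dis : [disjoint A `&` Z @^-1` S1 & A `&` Z @^-1` S2].
    apply/disj_setPS => w [[_ /=]] + [_ /=].
    rewrite /S1 /S2/= !in_itv/= => /andP[h1 _] /andP[_ h2].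
    by have := lt_le_trans h2 h1; rewrite ltxx.
  apply: (@le_trans _ _ (\int[mu]_(w in B k) `|W w|%:E)); last first.
    by apply: ge0_subset_integral => // w [].
  have subA : A `&` Z @^-1` S1 `|` A `&` Z @^-1` S2 `<=` A.
    by move=> w [] [].
  rewrite BE !ge0_integral_setU//; try by [exact: mAS|exact: measurable_funS mA subA _].
  apply: leeD.
    apply: (ZleW _ k%:R) => //; last left.
    - by move=> x; rewrite /S1/= in_itv/= => /andP[x0 xk]; rewrite ger0_norm.
    - by move=> x; rewrite /S1/= in_itv/= => /andP[].
  apply: (ZleW _ k%:R) => //; last right.
  - move=> x; rewrite /S2/= in_itv/= => /andP[x0 xk].
    by rewrite ltr0_norm// lerNl.
  - by move=> x; rewrite /S2/= in_itv/= => /andP[_ /ltW].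
have iZ : mu.-integrable A (EFin \o Z).
  apply/integrableP; split; first exact/measurable_EFinP.
  apply: (@le_lt_trans _ _ (\int[mu]_(w in A) `|W w|%:E)).
    rewrite -{1}cupB; apply: nondecreasing_integral_le => //.
    by rewrite cupB.
  by case/integrableP: iW.
split=> //.
(* Applied to both [Z] and [W], this passes the equality on each [B k] to [A]. *)
have cvg (f : Omega -> R) : mu.-integrable A (EFin \o f) ->
    \int[mu]_(w in B k) (f w)%:E @[k --> \oo] --> \int[mu]_(w in A) (f w)%:E.
  move=> iF.
  have BA k : B k = A `&` B k by rewrite setIidr// => w [].
  rewrite [X in X @ _](_ : _ = fun k =>
      \int[mu]_(w in A) ((EFin \o f) \_ (B k)) w); last first.
    by apply/funext => k; rewrite -integral_mkcondr -BA.
  have mf : measurable_fun A (EFin \o f) by case/integrableP: iF.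
  apply: (@dominated_cvg _ _ _ _ _ mA _ _ (fun w => `|(EFin \o f) w|)) => //.
  - move=> k; rewrite -measurable_restrict//; first by exact: measurable_funS mf.
  - move=> w Aw; apply: cvg_near_cst.
    have := Aw; rewrite -{1}cupB => -[k0 _ Bw].
    near=> k; rewrite patchE mem_set//; apply: homoB Bw.
    by near: k; exact: nbhs_infty_ge.
  - exact: integrable_abse.
  - by move=> k w Aw; rewrite patchE; case: ifP; rewrite ?abse0.
apply: (@cvg_unique _ _ _ _ _ _ (cvg _ iZ)) => //.
have -> : (fun k => \int[mu]_(w in B k) (Z w)%:E) =
          (fun k => \int[mu]_(w in B k) (W w)%:E).
  apply/funext => k; apply: (ZW _ k%:R) => // x /=.
  by rewrite in_itv/= -ler_norml.
exact: cvg.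
Unshelve. all: by end_near. Qed.
End TruncatedIntegral.

(** * Optional stopping at bounded times, by approximation on grids *)

Section OptionalStopping.
Context {d : measure_display} {Omega : measurableType d} {R : realType}.
Context (P : probability Omega R) (F : R -> set (set Omega)).

(** This strengthening of right continuity makes the values at times decreasing to [t] eventually
    equal to the value at [t], so that membership in an arbitrary set [S] passes to the limit. *)
Definition right_locally_constant (Y : R -> Omega -> R) :=
  forall w t, (0 <= t)%R -> exists2 e : R, (0 < e)%R &
    forall s, (t <= s)%R -> (s < t + e)%R -> Y s w = Y t w.

(* [grid_pt j (grid_index j x)] is the least multiple of [1 / (j + 1)] above
   [x >= 0]. *)
Definition grid_index (j : nat) (x : R) : nat := `|Num.ceil (x * j.+1%:R)|%N.

Definition grid_pt (j k : nat) : R := (k%:R / j.+1%:R)%R.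

(** Rounding up is adjoint to [grid_pt j], which turns events about the index into events that [rho]
    is below a grid point. *)
Lemma grid_index_le j k x : (0 <= x)%R ->
  (grid_index j x <= k)%N = (x <= grid_pt j k)%R.
Proof.
move=> x0; rewrite /grid_pt ler_pdivlMr ?ltr0n//.
have c0 : (0 <= Num.ceil (x * j.+1%:R))%R.
  by rewrite ceil_ge0 (lt_le_trans _ (mulr_ge0 x0 (ler0n _ _)))// ltrN10.
rewrite -(ler_nat int) natz /grid_index gez0_abs// natz.
by rewrite ceil_le_int.
Qed.

Lemma grid_index_ge j x : (0 <= x)%R -> (x <= grid_pt j (grid_index j x))%R.
Proof. by move=> x0; rewrite -grid_index_le. Qed.

Lemma grid_index_lt j x : (0 <= x)%R ->
  (grid_pt j (grid_index j x) < x + j.+1%:R^-1)%R.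
Proof.
move=> x0; have j0 : (0 < j.+1%:R^-1 :> R)%R by rewrite invr_gt0 ltr0n.
case E : (grid_index j x) => [|k]; first by rewrite /grid_pt mul0r ltr_wpDl.
have : ~~ (grid_index j x <= k)%N by rewrite E ltnn.
rewrite grid_index_le// -ltNge /grid_pt => kx.
by rewrite -natr1 mulrDl mul1r ltrD2r.
Qed.

(** On [A], [rho] is replaced by the grid time just above it, which takes finitely many values; the
    martingale property at each of them gives the identity, and the grid is then refined. Truncation
    to the bounded set [S] supplies a dominating constant before [Z] is known to be integrable. *)
Lemma optional_stopping_truncated (Y : R -> Omega -> R) (rho : Omega -> \bar R)
    (n : nat) (A : set Omega) (S : set R) (K : R) :
  filtration F -> martingale F P Y -> right_locally_constant Y ->
  stopping_time F rho ->
  (forall t, (0 <= t)%R -> F t (A `&` [set w | rho w <= t%:E])) ->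
  A `<=` [set w | rho w <= n%:R%:E] ->
  measurable S -> (forall x, S x -> (`|x| <= K)%R) ->
  let Z := fun w => Y (fine (rho w)) w in
  \int[P]_(w in A `&` Z @^-1` S) (Z w)%:E =
  \int[P]_(w in A `&` Z @^-1` S) (Y n%:R w)%:E.
Proof.
move=> hF [aY iY mgY] rY [rho0 srho] FA An mS SK Z.
have [_ sub mono] := hF.
have rfin w : A w -> rho w \is a fin_num.
  by move=> /An rn; rewrite ge0_fin_numE// (le_lt_trans rn) ?ltry.
have rE w x : A w -> (rho w <= x%:E) = (fine (rho w) <= x)%R.
  by move=> Aw; rewrite -{1}(fineK (rfin _ Aw)) lee_fin.
have rpos w : A w -> (0 <= fine (rho w))%R by move=> _; exact: fine_ge0.
have q0 j k : (0 <= grid_pt j k)%R by rewrite divr_ge0.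
pose ki j w := grid_index j (fine (rho w)).
pose Zj j w := Y (grid_pt j (ki j w)) w.
(* The constraint [S] is put on the grid value, not on [Z]: this makes [C j k] an event of
   [F (grid_pt j k)], as the martingale property requires. *)
pose C j k := (A `&` [set w | ki j w = k]) `&` Y (grid_pt j k) @^-1` S.
have FC j k : F (grid_pt j k) (C j k).
  apply: filtration_setI => //; last exact: aY.
  have FAk i : (i <= k)%N -> F (grid_pt j k) (A `&` [set w | (ki j w <= i)%N]).
    move=> ik; apply: (mono (grid_pt j i)) => //.
      by rewrite ler_pM2r ?invr_gt0 ?ltr0n// ler_nat.
    have -> : A `&` [set w | (ki j w <= i)%N] =
              A `&` [set w | rho w <= (grid_pt j i)%:E].
      apply/seteqP; split=> w /= [Aw]; by rewrite grid_index_le ?rpos// rE.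
    exact: FA.
  case: k FAk => [|k] FAk.
    have -> : A `&` [set w | ki j w = 0%N] = A `&` [set w | (ki j w <= 0)%N].
      by apply/seteqP; split=> w /= [Aw]; [move=> ->|rewrite leqn0 => /eqP].
    exact: FAk.
  have -> : A `&` [set w | ki j w = k.+1] =
      (A `&` [set w | (ki j w <= k.+1)%N]) `\` (A `&` [set w | (ki j w <= k)%N]).
    apply/seteqP; split=> w /=.
      by move=> [Aw ->]; split=> // -[_]; rewrite ltnn.
    move=> [[Aw h1] h2]; split=> //; apply/eqP; rewrite eqn_leq h1/= ltnNge.
    by apply/negP => h3; exact: h2.
  by apply: filtration_setD => //; apply: FAk.
have mC j k : measurable (C j k) by exact: sub (FC j k).
have trivC j : trivIset setT (C j).
  by move=> k l _ _ [w [[[_ <-] _] [[_ <-] _]]].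
(* Since [n] is an integer, it is the grid point of index [n * j.+1]; rounding [rho <= n] up never
   passes it. *)
have Ck0 j k : (n * j.+1 < k)%N -> C j k = set0.
  move=> nk; apply/seteqP; split=> // w [[Aw /= kE] _].
  have : (ki j w <= n * j.+1)%N.
    rewrite grid_index_le ?rpos// /grid_pt natrM mulfK ?pnatr_eq0//.
    by rewrite -lee_fin fineK ?rfin//; exact: An.
  by rewrite kE leqNgt nk.
have CE j : A `&` Zj j @^-1` S = \bigcup_k C j k.
  apply/seteqP; split=> w /=.
    by move=> [Aw Sw]; exists (ki j w).
  by move=> [k _ [[Aw /= <-] Sw]].
have CbE j : \bigcup_k C j k = \big[setU/set0]_(k <- iota 0 (n * j.+1).+1) C j k.
  rewrite -bigcup_seq; apply/seteqP; split=> w /= [k _ Cw]; last by exists k.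
  exists k => //; suff : k \in iota 0 (n * j.+1).+1 by [].
  rewrite mem_iota/= add0n ltnS leqNgt; apply/negP => /(Ck0 j).
  by move=> C0; rewrite C0 in Cw.
have mCU j : measurable (\bigcup_k C j k) by exact: bigcupT_measurable.
have mY t : (0 <= t)%R -> measurable_fun setT (Y t).
  by move=> /iY /integrableP[/measurable_EFinP].
have mZj j : measurable_fun (\bigcup_k C j k) (Zj j).
  apply/measurable_fun_bigcup => // k.
  apply: (eq_measurable_fun (Y (grid_pt j k))).
    by move=> w; rewrite inE => -[[_ <-]].
  exact: measurable_funTS (mY _ _).
have disc j : \int[P]_(w in \bigcup_k C j k) (Zj j w)%:E =
              \int[P]_(w in \bigcup_k C j k) (Y n%:R w)%:E.
  rewrite CbE !integral_bigsetU_EFin ?iota_uniq//; try exact: sub_trivIset (trivC j).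
  - rewrite !big_seq; apply: eq_bigr => k; rewrite mem_iota/= add0n ltnS => kn.
    transitivity (\int[P]_(w in C j k) (Y (grid_pt j k) w)%:E).
      by apply: eq_integral => w; rewrite inE => -[[_ <-]].
    symmetry; apply: mgY => //.
    by rewrite ler_pdivrMr ?ltr0n// -natrM ler_nat.
  - by rewrite -CbE; apply/measurable_EFinP; exact: measurable_funTS (mY _ _).
  - by rewrite -CbE; apply/measurable_EFinP.
have ev w : A w -> \forall j \near \oo, Zj j w = Z w.
  move=> Aw; have [e e0 he] := rY w _ (rpos _ Aw).
  near=> j; apply: he; first exact: grid_index_ge (rpos _ Aw).
  apply: (lt_le_trans (grid_index_lt _ (rpos _ Aw))).
  rewrite lerD2l; apply/ltW; near: j; exact: near_infty_natSinv_lt (PosNum e0).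
(* Integrand and domain both depend on [j]; after extension by zero everything is eventually
   constant at each point. It serves for [Zj], dominated by [K], and for [Y n], dominated by its
   absolute value. *)
have cvg (f : nat -> Omega -> R) (g b : Omega -> R) :
    (forall j, measurable_fun (\bigcup_k C j k) (f j)) ->
    (forall w, A w -> \forall j \near \oo, f j w = g w) ->
    (forall j w, (\bigcup_k C j k) w -> (`|f j w| <= b w)%R) ->
    P.-integrable setT (EFin \o b) ->
    \int[P]_(w in \bigcup_k C j k) (f j w)%:E @[j --> \oo] -->
    \int[P]_(w in A `&` Z @^-1` S) (g w)%:E.
  move=> mf fg fb ib.
  under eq_fun do rewrite integral_mkcond.
  rewrite (integral_mkcond (A `&` Z @^-1` S)).
  apply: (@dominated_cvg _ _ _ _ _ measurableT _ _ (EFin \o (fun w => `|b w|%R))) => //.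
  - by move=> j; apply/(measurable_restrictT _ _).1 => //; exact/measurable_EFinP.
  - move=> w _; apply: cvg_near_cst.
    have [Aw|nAw] := pselect (A w); last first.
      by near=> j; rewrite !patchE !memNset// -?CE => -[].
    near=> j; rewrite !patchE -CE.
    have ZE : Zj j w = Z w by near: j; exact: ev.
    have fE : f j w = g w by near: j; exact: fg.
    have -> : (w \in A `&` Zj j @^-1` S) = (w \in A `&` Z @^-1` S).
      by apply/asboolP/asboolP => -[_ /= Sw]; split=> //=; move: Sw; rewrite ZE.
    by rewrite /= fE.
  - by rewrite (_ : _ \o _ = abse \o (EFin \o b))//; exact: integrable_abse.
  - move=> j w _; rewrite patchE; case: ifP => [|_]; last first.
      by rewrite abse0 lee_fin.
    rewrite inE => /(fb j w) fbw; rewrite /= lee_fin (le_trans fbw)//.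
    exact: ler_norm.
apply: (@cvg_unique _ _ (\int[P]_(w in \bigcup_k C j k) (Zj j w)%:E @[j --> \oo])) => //.
- apply: (cvg _ _ (cst K)) => // [j w [k _ [[_ /= kE] /= Sw]]|].
    by apply: SK; rewrite /Zj kE.
  exact: finite_measure_integrable_cst.
- have -> : (fun j => \int[P]_(w in \bigcup_k C j k) (Zj j w)%:E) =
    (fun j => \int[P]_(w in \bigcup_k C j k) (Y n%:R w)%:E) by exact/funext.
  apply: (cvg _ _ (fun w => `|Y n%:R w|%R)) => //.
  + by move=> j; exact: measurable_funTS (mY _ _).
  + by move=> w _; near=> j.
  + rewrite (_ : _ \o _ = abse \o (EFin \o Y n%:R))//.
    by apply: integrable_abse => //; exact: iY.
Unshelve. all: by end_near. Qed.

(** [truncated_integral] with [Y n] as [W] removes the truncation; integrability of the stopped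
    value is an output, not an assumption. *)
Lemma optional_stopping (Y : R -> Omega -> R) (rho : Omega -> \bar R)
    (n : nat) (A : set Omega) :
  filtration F -> martingale F P Y -> right_locally_constant Y ->
  stopping_time F rho ->
  (forall t, (0 <= t)%R -> F t (A `&` [set w | rho w <= t%:E])) ->
  A `<=` [set w | rho w <= n%:R%:E] ->
  let Z := fun w => Y (fine (rho w)) w in
  measurable_fun A Z ->
  P.-integrable A (EFin \o Z) /\
  \int[P]_(w in A) (Z w)%:E = \int[P]_(w in A) (Y n%:R w)%:E.
Proof.
move=> hF hY rY srho FA An Z mZ.
have mA : measurable A.
  rewrite (_ : A = A `&` [set w | rho w <= n%:R%:E]); last exact/esym/setIidl.
  by have [_ sub _] := hF; apply: (sub n%:R) => //; exact: FA.
apply: truncated_integral => //.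
  by apply: (integrableS measurableT) => //; case: hY => _ iY _; exact: iY.
by move=> S K mS SK; exact: optional_stopping_truncated SK.
Qed.

(** After [tau] the stopped path is frozen; before [tau] the interval is shrunk so as not to pass
    [tau]. *)
Lemma stopped_right_locally_constant (X : R -> Omega -> R) tau :
  (forall w, 0 <= tau w) -> right_locally_constant X ->
  right_locally_constant (stopped X tau).
Proof.
move=> tau0 rX w t t0; have [tt|tt] := leP (tau w) t%:E.
  exists 1%R => // s ts _; rewrite /stopped !min_r//.
  by rewrite (le_trans tt)// lee_fin.
have [e e0 he] := rX w t t0.
have [e' e'0 he'] : exists2 e' : R, (0 < e')%R &
    forall s, (s < t + e')%R -> s%:E <= tau w.
  case E : (tau w) tt => [r| |]//= tr; last by exists 1%R => // s _; exact: leey.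
  rewrite lte_fin in tr; exists (r - t)%R; first lra.
  by move=> s sr; rewrite lee_fin; lra.
exists (Num.min e e'); first by rewrite lt_min e0.
move=> s ts; rewrite addr_minr lt_min => /andP[se /he' se'].
by rewrite /stopped !min_l ?(ltW tt)//; exact: he.
Qed.

End OptionalStopping.

(** Measurability of [f] is asked on [E] alone because an [F_at F rho]-measurable variable is known
    at time [t] on [{rho <= t}]. *)
Lemma measurable_fun_mul_mem {d : measure_display} {T : measurableType d}
    {R : realType} (E : set T) (f : T -> R) : measurable E ->
  measurable_fun E f ->
  measurable_fun setT (fun w => (f w * (w \in E)%:R)%R).
Proof.
move=> mE mf; rewrite -(setUv E); apply/measurable_funU => //.
  exact: measurableC.
split.
  apply: eq_measurable_fun mf => w wE; by rewrite wE mulr1.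
apply: (eq_measurable_fun (fun=> 0%R : R)) => [w|]; last exact: measurable_cst.
by rewrite inE => nE; rewrite memNset// mulr0.
Qed.

(** * Paths and measurability of the jump process *)

Section JumpProcess.
Context {d : measure_display} {Omega : measurableType d} {R : realType}.
Context (F : R -> set (set Omega)) (hF : filtration F).
Context (N : nat) (rho : nat -> Omega -> \bar R) (J : nat -> Omega -> R).
Context (srho : forall m, stopping_time F (rho m)).
Context (rho_nd : forall m w, rho m w <= rho m.+1 w).
Context (mJ : forall m, measurable_wrt (F_at F (rho m)) (J m)).

(* The value at [+oo] counts the jumps at finite times only. *)
Definition jump_sum (r : \bar R) (w : Omega) : R :=
  (\sum_(m < N) J m w * ((rho m w <= r)%E && (rho m w < +oo)%E)%:R)%R.

(** The index is shifted by one, so that index 0 is the deterministic time 0, where the forward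
    induction starts. *)
Definition jump_time (k : nat) (w : Omega) : \bar R :=
  if k is m.+1 then rho m w else 0.

Lemma stopping_time_jump_time k : stopping_time F (jump_time k).
Proof. by case: k => [|m]; [exact: stopping_time_cst|exact: srho]. Qed.

Lemma jump_time_le w : {homo jump_time^~ w : k l / (k <= l)%N >-> k <= l}.
Proof.
apply: homo_leq => [//|x y z|[|m]]; first exact: le_trans.
  by rewrite /= (srho 0).1.
exact: rho_nd.
Qed.

(** At [jump_time k] the jumps [m < k] have occurred, and the others come no earlier than
    [jump_time k.+1]. The second alternative allows [r = +oo], since jumps at [+oo] are not
    counted. *)
Lemma jump_sum_between k r w : jump_time k w <= r ->
  r < jump_time k.+1 w \/ jump_time k.+1 w = +oo ->
  jump_sum r w = jump_sum (jump_time k w) w.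
Proof.
move=> kr rk; apply: eq_bigr => m _; congr (_ * _%:R)%R.
have [mk|km] := ltnP m k.
  have mk' : rho m w <= jump_time k w by exact: (@jump_time_le w m.+1 k).
  by rewrite mk' (le_trans mk').
have km' : jump_time k.+1 w <= rho m w by exact: (@jump_time_le w k.+1 m.+1).
case: rk => [rk|rk]; last first.
  by rewrite rk in km'; rewrite (ltNge (rho m w)) km' !andbF.
have rm := lt_le_trans rk km'.
by rewrite !leNgt rm (le_lt_trans kr rm).
Qed.

(** The last jump time up to [r] is the one to take. The whole path thus has finitely many values,
    which yields the dominating variable. *)
Lemma jump_sum_jump_time k r w : r < jump_time k w \/ jump_time k w = +oo ->
  0 <= r -> exists2 j, (j < k)%N & jump_sum r w = jump_sum (jump_time j w) w.
Proof.
elim: k => [|k IH]; first by case=> [/=|/=]; [rewrite ltNge => /negbTE ->|].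
move=> rk r0; have [kr|rk'] := leP (jump_time k w) r.
  by exists k => //; exact: jump_sum_between.
by have [j jk ->] := IH (or_introl rk') r0; exists j => //; exact: ltnW.
Qed.

(** Each indicator stays constant for a while after [t]; the smallest of finitely many such
    durations serves for the sum. *)
Lemma jump_sum_right_locally_constant :
  right_locally_constant (fun t => jump_sum t%:E).
Proof.
move=> w t t0.
have step m : exists2 e : R, (0 < e)%R & forall s : R, (t <= s)%R ->
    (s < t + e)%R -> (rho m w <= s%:E) = (rho m w <= t%:E).
  have [mt|tm] := leP (rho m w) t%:E.
    by exists 1%R => // s ts _; rewrite (le_trans mt)// lee_fin.
  case E : (rho m w) tm => [r| |]//= tr.
  - rewrite lte_fin in tr; exists (r - t)%R; first lra.
    by move=> s ts sr; rewrite lee_fin; apply/negbTE; rewrite -ltNge; lra.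
  - by exists 1%R.
suff [e e0 he] : exists2 e : R, (0 < e)%R & forall s : R, (t <= s)%R ->
    (s < t + e)%R -> forall m, (m < N)%N -> (rho m w <= s%:E) = (rho m w <= t%:E).
  exists e => // s ts se; apply: eq_bigr => m _; congr (_ * (_ && _)%:R)%R.
  exact: he.
elim: N => [|k [e e0 he]]; first by exists 1%R.
have [e' e'0 he'] := step k.
exists (Num.min e e'); first by rewrite lt_min e0.
move=> s ts; rewrite addr_minr lt_min => /andP[se se'] m.
by rewrite ltnS leq_eqVlt => /orP[/eqP ->|mk]; [exact: he'|exact: he].
Qed.

Lemma jump_sum_stopped_measurable a t : stopping_time F a -> (0 <= t)%R ->
  measurable_wrt (F t) (fun w => jump_sum (mine t%:E (a w)) w).
Proof.
move=> sa t0; have [sF _ _] := hF; have sFt := sF _ t0.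
apply/(measurable_wrtP _ sFt); apply: measurable_sum => m.
pose E := [set w | rho m w <= a w] `&` [set w | rho m w <= t%:E].
have FE : F t E by exact: stopping_time_le.
rewrite (_ : (fun _ => _) = (fun w => J m w * (w \in E)%:R)%R); last first.
  apply/funext => w; congr (_ * (nat_of_bool _)%:R)%R.
  apply/idP/idP => [/andP[]|].
      by rewrite le_min => /andP[h1 h2] _; rewrite inE.
    rewrite inE => -[/= h1 h2]; rewrite le_min h1 h2/=.
    exact: le_lt_trans h2 (ltry _).
apply: measurable_fun_mul_mem; first exact/(sigma_algebra_measurableE _ sFt).
move=> _ B mB; apply/(sigma_algebra_measurableE _ sFt).
(* [F_at] yields preimages cut by [{rho m <= t}]; [E] lies in that event, so the cut changes
   nothing. *)
have -> : E `&` J m @^-1` B = E `&` (J m @^-1` B `&` [set w | rho m w <= t%:E]).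
  by apply/seteqP; split=> w; rewrite /E/=; tauto.
by apply: filtration_setI => //; exact: (mJ m mB).2.
Qed.

Lemma jump_sum_measurable a : stopping_time F a ->
  measurable_fun setT (fun w => jump_sum (a w) w).
Proof.
move=> sa; have [_ sub _] := hF; apply: measurable_sum => m.
(* The factor [rho m w < +oo] becomes a union over integer bounds, to which [stopping_time_le]
   applies. *)
pose E := \bigcup_(n : nat)
  ([set w | rho m w <= a w] `&` [set w | rho m w <= n%:R%:E]).
have mE : measurable E.
  by apply: bigcupT_measurable => n; apply: (sub n%:R%R) => //; exact: stopping_time_le.
rewrite (_ : (fun _ => _) = (fun w => J m w * (w \in E)%:R)%R); last first.
  apply/funext => w; congr (_ * (nat_of_bool _)%:R)%R.
  apply/idP/idP => [/andP[h1 h2]|].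
      rewrite inE; exists (Num.truncn (fine (rho m w))).+1 => //; split=> //=.
      have rf : rho m w \is a fin_num by rewrite ge0_fin_numE// (srho m).1.
      by rewrite -{1}(fineK rf) lee_fin; apply/ltW/truncnS_gt.
    rewrite inE => -[n _ [/= h1 h2]]; rewrite h1/=.
    exact: le_lt_trans h2 (ltry _).
apply: measurable_fun_mul_mem => //.
by move=> _ B mB; apply: measurableI => //; exact: (mJ m mB).1.
Qed.

(** On [{a <= t}] the time [a] equals [min t a], and the value there is known at time [t]. This
    makes sign events of the jump values admissible for optional stopping. *)
Lemma jump_sum_preimage_F_at a (S : set R) t : stopping_time F a ->
  measurable S -> (0 <= t)%R ->
  F t ((fun w => jump_sum (a w) w) @^-1` S `&` [set w | a w <= t%:E]).
Proof.
move=> sa mS t0.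
have -> : (fun w => jump_sum (a w) w) @^-1` S `&` [set w | a w <= t%:E] =
    (fun w => jump_sum (mine t%:E (a w)) w) @^-1` S `&` [set w | a w <= t%:E].
  by apply/seteqP; split=> w /= [Sw aw]; split=> //; move: Sw; rewrite min_r.
apply: filtration_setI => //; first exact: jump_sum_stopped_measurable.
by case: sa => _; exact.
Qed.

Lemma jump_sum_eventually w : exists2 t0 : R, (0 <= t0)%R &
  forall t, (t0 <= t)%R -> jump_sum t%:E w = jump_sum +oo w.
Proof.
suff [t0 t00 ht] : exists2 t0 : R, (0 <= t0)%R & forall t, (t0 <= t)%R ->
    forall m, (m < N)%N -> rho m w < +oo -> rho m w <= t%:E.
  exists t0 => // t t0t; apply: eq_bigr => m _; congr (_ * (nat_of_bool _)%:R)%R.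
  rewrite leey/=; case: (ltP (rho m w) +oo) => h; rewrite ?andbF// andbT.
  exact: ht.
elim: N => [|k [t0 t00 ht]]; first by exists 0%R.
exists (Num.max t0 (fine (rho k w))); first by rewrite le_max t00.
move=> t; rewrite ge_max => /andP[t0t kt] m.
rewrite ltnS leq_eqVlt => /orP[/eqP ->|mk] h; last exact: ht.
by rewrite -(@fineK _ (rho k w)) ?lee_fin// ge0_fin_numE// (srho k).1.
Qed.

(** Every path is constant past its last finite jump time, so the lower limit is the final value. *)
Lemma liminf_negpart_jump_sum (M : R -> Omega -> R) w :
  (forall t, (0 <= t)%R -> M t w = jump_sum t%:E w) ->
  liminf_pinfty (fun t => (negpart (M t w))%:E) =
  (negpart (jump_sum +oo w))%:E.
Proof.
move=> ME; have [t0 t00 ht] := jump_sum_eventually w.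
apply/eqP; rewrite eq_le; apply/andP; split.
  apply: ge_ereal_sup => _ [s /= s0 <-].
  apply: ereal_inf_lbound; exists (Num.max s t0) => /=.
    by rewrite le_max lexx.
  by rewrite ME ?le_max ?s0// ht// le_max lexx orbT.
apply: (@le_trans _ _ (ereal_inf [set (negpart (M t w))%:E | t in [set t | (t0 <= t)%R]])).
  apply: le_ereal_inf_tmp => _ [t /= t0t <-].
  by rewrite ME ?ht// (le_trans t00).
by apply: ereal_sup_ubound; exists t0.
Qed.

End JumpProcess.

(** * Propagation of integrability along the jump times *)

Section JumpLocalMartingale.
Context {d : measure_display} {Omega : measurableType d} {R : realType}.
Context (P : probability Omega R).
Context (F : R -> set (set Omega)) (hF : filtration F).
Context (N : nat) (rho : nat -> Omega -> \bar R) (J : nat -> Omega -> R).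
Context (srho : forall m, stopping_time F (rho m)).
Context (rho_nd : forall m w, rho m w <= rho m.+1 w).
Context (mJ : forall m, measurable_wrt (F_at F (rho m)) (J m)).
Context (M : R -> Omega -> R).
Context (ME : forall t w, (0 <= t)%R -> M t w = jump_sum N rho J t%:E w).
Context (tau : nat -> Omega -> \bar R) (stau : forall n, stopping_time F (tau n)).
Context (tau_nd : forall n w, tau n w <= tau n.+1 w).
Context (tau_cvg : forall w, tau ^~ w @ \oo --> +oo).
Context (mtau : forall n, martingale F P (stopped M (tau n))).

Let V k w : R := jump_sum N rho J (jump_time rho k w) w.
(** The localizing time is capped at [n] because optional stopping is applied at bounded times; the
    events [E k n] still increase to [{jump_time k < +oo}]. *)
Let sigma n w : \bar R := mine (tau n w) n%:R%:E.
Let E k n : set Omega := [set w | jump_time rho k w <= sigma n w].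

Let sjt k : stopping_time F (jump_time rho k).
Proof. exact: stopping_time_jump_time. Qed.

Let ssigma n : stopping_time F (sigma n).
Proof. exact: stopping_time_min_cst. Qed.

Let M_fine r w : 0 <= r -> r < +oo -> M (fine r) w = jump_sum N rho J r w.
Proof.
move=> r0 roo; rewrite ME ?fine_ge0// fineK// ge0_fin_numE//.
Qed.

Let M_right_locally_constant : right_locally_constant M.
Proof.
move=> w t t0; have [e e0 he] := jump_sum_right_locally_constant N rho J w t0.
exists e => // s ts se; rewrite (ME _ t0) ME ?(le_trans t0)//; exact: he.
Qed.

Let measurable_V k : measurable_fun setT (V k).
Proof. exact: (@jump_sum_measurable _ _ _ F). Qed.

Let E_le k n w : E k n w -> jump_time rho k w <= n%:R%:E.
Proof. by rewrite /E/= /sigma le_min => /andP[]. Qed.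

Let F_E k n t : (0 <= t)%R -> F t (E k n `&` [set w | jump_time rho k w <= t%:E]).
Proof. by move=> t0; exact: stopping_time_le. Qed.

Let measurable_E k n : measurable (E k n).
Proof.
rewrite (_ : E k n = E k n `&` [set w | jump_time rho k w <= n%:R%:E]).
  by have [_ sub _] := hF; apply: (sub n%:R%R) => //; exact: F_E.
by apply/esym/setIidl => w /E_le.
Qed.

Let E_nd k : {homo E k : n m / (n <= m)%N >-> n `<=` m}.
Proof.
move=> n m nm w; rewrite /E/= => h; apply: (le_trans h).
have tnm : tau n w <= tau m w.
  by apply: (@homo_leq _ (tau^~ w) <=%O%E) nm => // x y z; exact: le_trans.
rewrite /sigma le_min !ge_min tnm/=.
by rewrite lee_fin ler_nat nm orbT.
Qed.

Let E_cup k : \bigcup_n E k n = [set w | jump_time rho k w < +oo].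
Proof.
apply/seteqP; split=> w /=.
  by move=> [n _ /E_le h]; exact: le_lt_trans h (ltry _).
move=> koo; have kfin : jump_time rho k w \is a fin_num.
  by rewrite ge0_fin_numE// (sjt k).1.
have [n _ hn] : \forall n \near \oo, jump_time rho k w <= tau n w.
  rewrite -(fineK kfin); have := @tau_cvg w.
  by move=> /cvgeyPge/(_ (fine (jump_time rho k w))).
pose m := maxn n (Num.truncn (fine (jump_time rho k w))).+1.
exists m => //; rewrite /E/= /sigma le_min hn/= ?leq_maxl//.
rewrite -{1}(fineK kfin) lee_fin (le_trans (ltW (truncnS_gt _)))//.
by rewrite ler_nat leq_maxr.
Qed.

Let E_compl k : ~` (\bigcup_n E k n) = [set w | jump_time rho k w = +oo].
Proof.
rewrite E_cup; apply/seteqP; split=> w /=; last by move=> ->.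
by move/negP; rewrite -leNgt leye_eq => /eqP.
Qed.

Let measurable_jump_time_pinfty k : measurable [set w | jump_time rho k w = +oo].
Proof. by rewrite -E_compl; exact/measurableC/bigcupT_measurable. Qed.

(** On [A] the jump time is at most [tau n], so stopping at [tau n] leaves the value [V k] untouched
    and the stopped martingale can stand for [M]. *)
Let optional_stopping_V k n A :
  (forall t, (0 <= t)%R -> F t (A `&` [set w | jump_time rho k w <= t%:E])) ->
  A `<=` E k n ->
  P.-integrable A (EFin \o V k) /\
  \int[P]_(w in A) (V k w)%:E = \int[P]_(w in A) (stopped M (tau n) n%:R w)%:E.
Proof.
move=> FA AE.
have An : A `<=` [set w | jump_time rho k w <= n%:R%:E] by move=> w /AE /E_le.
have VE w : A w -> stopped M (tau n) (fine (jump_time rho k w)) w = V k w.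
  move=> Aw; rewrite /stopped; have koo := le_lt_trans (An _ Aw) (ltry _).
  have k0 := (sjt k).1 w.
  rewrite fineK ?ge0_fin_numE// min_l ?M_fine//.
  by have := AE _ Aw; rewrite /E/= /sigma le_min => /andP[].
have mA : measurable A.
  have [_ sub _] := hF; rewrite -(setIidl An).
  by apply: (sub n%:R%R) => //; exact: FA.
have rlc : right_locally_constant (stopped M (tau n)).
  by apply: stopped_right_locally_constant => // w; case: (stau n).
have [|iZ eZ] := @optional_stopping _ _ _ P F _ _ n A hF (mtau n) rlc (sjt k) FA An.
  apply: (eq_measurable_fun (V k)); first by move=> w; rewrite inE => /VE.
  exact: measurable_funTS.
split.
  by apply: eq_integrable iZ => // w; rewrite inE => Aw; rewrite /= VE.
by rewrite -eZ; apply: eq_integral => w; rewrite inE => Aw; rewrite /= VE.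
Qed.

(* Between two consecutive jump times [M] is constant, so the part of [A] on
   which stopping occurs before the next jump contributes equally to both
   sides of the optional stopping identity and cancels. *)
Let integral_step k n A :
  (forall t, (0 <= t)%R -> F t (A `&` [set w | jump_time rho k w <= t%:E])) ->
  A `<=` E k n ->
  let D := A `&` E k.+1 n in
  [/\ P.-integrable D (EFin \o V k), P.-integrable D (EFin \o V k.+1) &
  \int[P]_(w in D) (V k w)%:E = \int[P]_(w in D) (V k.+1 w)%:E].
Proof.
move=> FA AE D.
have [iA eA] := optional_stopping_V FA AE.
have mA : measurable A.
  have [_ sub _] := hF; rewrite (_ : A = A `&` [set w | jump_time rho k w <= n%:R%:E]).
    by apply: (sub n%:R%R) => //; exact: FA.
  by apply/esym/setIidl => w /AE/E_le.
have mD : measurable D by exact: measurableI.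
have jtS w : jump_time rho k w <= jump_time rho k.+1 w.
  by apply: jump_time_le => //; exact: srho.
have FD t : (0 <= t)%R -> F t (D `&` [set w | jump_time rho k.+1 w <= t%:E]).
  move=> t0.
  have -> : D `&` [set w | jump_time rho k.+1 w <= t%:E] =
     (A `&` [set w | jump_time rho k w <= t%:E]) `&`
     (E k.+1 n `&` [set w | jump_time rho k.+1 w <= t%:E]).
    apply/seteqP; split=> w /=; last by move=> [[? ?] []].
    by move=> [[Aw Ew] kt]; split=> //; split=> //; exact: le_trans (jtS w) kt.
  by apply: filtration_setI => //; [exact: FA|exact: F_E].
have [iD eD] := optional_stopping_V FD (@subIsetr _ _ _).
have iDk : P.-integrable D (EFin \o V k) by apply: integrableS iA => // w [].
split=> //; rewrite eD.
pose B := A `\` E k.+1 n; have mB : measurable B by exact: measurableD.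
have AB : A = D `|` B by rewrite /D /B setUIDK.
have dis : [disjoint D & B] by apply/disj_setPS => w [[_ ?] []].
have mY : measurable_fun setT (EFin \o stopped M (tau n) n%:R).
  by have [_ iY _] := mtau n; case/integrableP: (iY n%:R%R (ler0n _ _)).
have mV : measurable_fun setT (EFin \o V k) by exact/measurable_EFinP.
(* On [B] the [k]-th jump time has passed by [sigma n] and the next one comes later: [M] at
   [sigma n], which is the stopped process at time [n], still equals [V k]. *)
have eB : \int[P]_(w in B) (V k w)%:E =
          \int[P]_(w in B) (stopped M (tau n) n%:R w)%:E.
  apply: eq_integral => w; rewrite inE => -[Aw nE]; congr (_%:E).
  have Ek := AE _ Aw; rewrite /E/= in Ek.
  have k0 := (sjt k).1 w.
  have soo : sigma n w < +oo.
    by rewrite /sigma (@le_lt_trans _ _ n%:R%:E) ?ltry// ge_min lexx orbT.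
  rewrite /stopped minC M_fine//; last exact: le_trans Ek.
  symmetry; apply: jump_sum_between => //; left.
  by rewrite ltNge; apply/negP.
move: eA; rewrite {1 2}AB.
rewrite !integral_setU//; try exact: measurable_funTS.
(* Cancelling in the extended reals needs a finite integral over [B]; integrability of [V k] on [A]
   provides it. *)
rewrite eB => /(congr1 (fun x => x - \int[P]_(w in B) (stopped M (tau n) n%:R w)%:E)).
by rewrite !addeK// -eB; apply: integrable_fin_num => //;
  apply: integrableS iA => // w [].
Qed.

(** The space splits into [{jump_time k < +oo}], exhausted by the [E k n] so that monotone
    convergence applies, and its complement. *)
Let integral_split k (f : Omega -> R) (C1 C2 : \bar R) :
  measurable_fun setT f -> (forall w, (0 <= f w)%R) ->
  (forall n, \int[P]_(w in E k n) (f w)%:E <= C1) ->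
  \int[P]_(w in [set w | jump_time rho k w = +oo]) (f w)%:E <= C2 ->
  \int[P]_w (f w)%:E <= C1 + C2.
Proof.
move=> mf f0 h1 h2.
have mEf : measurable_fun setT (EFin \o f) by exact/measurable_EFinP.
have mU : measurable (\bigcup_n E k n) by exact: bigcupT_measurable.
have -> : [set: Omega] = \bigcup_n E k n `|` ~` (\bigcup_n E k n) by rewrite setUv.
rewrite ge0_integral_setU//.
- apply: leeD; last by rewrite E_compl.
  by apply: nondecreasing_integral_le => //; exact: measurable_funTS.
- exact: measurableC.
- exact: measurable_funTS.
- by move=> w _; rewrite lee_fin.
- by apply/disj_setPS => w [].
Qed.

Let V_pinfty k w : jump_time rho k.+1 w = +oo -> V k.+1 w = V k w.
Proof.
move=> koo; rewrite /V koo.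
by apply: jump_sum_between; [exact: srho|exact: rho_nd|exact: leey|right].
Qed.

Let measurable_negpart k : measurable_fun setT (fun w => negpart (V k w)).
Proof.
apply: measurable_maxr => //; exact: measurable_funN.
Qed.

Let negpart_ge0 (x : R) : (0 <= negpart x)%R.
Proof. by rewrite le_max lexx orbT. Qed.

(** This is conditional Jensen by hand: on [{V k < 0}] within [E k.+1 n], the integral of [- V k]
    equals that of [- V k.+1], at most [C]. Where the next jump never comes, [V k = V k.+1], which
    costs the second [C]. *)
Lemma integral_negpart_backward k :
  \int[P]_w (negpart (V k.+1 w))%:E < +oo -> \int[P]_w (negpart (V k w))%:E < +oo.
Proof.
move=> fin; set C := \int[P]_w (negpart (V k.+1 w))%:E in fin.
apply: (@le_lt_trans _ _ (C + C)); last exact: lte_add_pinfty.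
have mn j : measurable_fun setT (fun w => (negpart (V j w))%:E).
  exact/measurable_EFinP.
apply: (@integral_split k.+1) => //; last first.
  have -> : \int[P]_(w in [set w | jump_time rho k.+1 w = +oo]) (negpart (V k w))%:E
          = \int[P]_(w in [set w | jump_time rho k.+1 w = +oo]) (negpart (V k.+1 w))%:E.
    by apply: eq_integral => w; rewrite inE/= => /V_pinfty ->.
  by apply: ge0_subset_integral => // w _; rewrite lee_fin.
move=> n; pose A := (V k @^-1` `]-oo, 0%R[) `&` E k n.
have FA t : (0 <= t)%R -> F t (A `&` [set w | jump_time rho k w <= t%:E]).
  move=> t0.
  have -> : A `&` [set w | jump_time rho k w <= t%:E] =
    (V k @^-1` `]-oo, 0%R[ `&` [set w | jump_time rho k w <= t%:E]) `&`
    (E k n `&` [set w | jump_time rho k w <= t%:E]).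
    by apply/seteqP; split=> w; rewrite /A/=; tauto.
  apply: filtration_setI => //; last exact: F_E.
  exact: jump_sum_preimage_F_at.
have [iV iVS eV] := integral_step FA (@subIsetr _ _ _).
set D := A `&` E k.+1 n in iV iVS eV.
have mV0 : measurable (V k @^-1` `]-oo, 0%R[).
  by rewrite -[X in measurable X]setTI; exact: measurable_V.
have mD : measurable D by apply: measurableI => //; exact: measurableI.
have ES w : E k.+1 n w -> E k n w.
  by apply: le_trans; apply: jump_time_le => //; exact: srho.
(* [negpart (V k)] vanishes off [{V k < 0}], and [E k.+1 n] lies inside [E k n], so [D] carries the
   whole integral. *)
have EE : \int[P]_(w in E k.+1 n) (negpart (V k w))%:E =
          \int[P]_(w in D) (- (V k w)%:E).
  rewrite [LHS]integral_mkcond [RHS]integral_mkcond.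
  apply: eq_integral => w _; rewrite !patchE.
  have [Ew|nEw] := pselect (E k.+1 n w); last first.
    by rewrite !memNset// => -[].
  rewrite (mem_set Ew); have [V0|V0] := ltP (V k w) 0%R.
    rewrite mem_set; last by split=> //; split; [rewrite /= in_itv|exact: ES].
    by rewrite /negpart max_l// lerNr oppr0 ltW.
  rewrite memNset; last by move=> -[[/=]]; rewrite in_itv/= ltNge V0.
  by rewrite /negpart max_r// lerNl oppr0.
rewrite EE.
have iN j : P.-integrable D (EFin \o V j) ->
   \int[P]_(w in D) - (V j w)%:E = - \int[P]_(w in D) (V j w)%:E.
  by move=> iVj; rewrite integralN//; exact: integrable_add_def.
rewrite iN// eV -iN//.
apply: (@le_trans _ _ (\int[P]_(w in D) (negpart (V k.+1 w))%:E)); last first.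
  by apply: ge0_subset_integral => // w _; rewrite lee_fin.
apply: le_integral => //.
- exact: integrableN iVS.
- apply: (le_integrable mD _ _ iVS); first exact: measurable_funTS.
  move=> w _ /=; rewrite lee_fin ger0_norm// /negpart ge_max normr_ge0 andbT.
  by rewrite -normrN ler_norm.
- by move=> w _; rewrite -EFinN lee_fin le_max lexx.
Qed.

(** Since [|x| = x + 2 x^-], on [E k.+1 n] the first term integrates as [V k] does, to at most [B],
    and the negative parts add [C + C]. The last [B] is for the event where the next jump never
    comes and [V k.+1 = V k]. *)
Lemma integrable_forward k : P.-integrable setT (EFin \o V k) ->
  \int[P]_w (negpart (V k.+1 w))%:E < +oo -> P.-integrable setT (EFin \o V k.+1).
Proof.
move=> iV fin; set C := \int[P]_w (negpart (V k.+1 w))%:E in fin.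
pose B := \int[P]_w `|V k w|%:E.
have Boo : B < +oo by case/integrableP: iV.
have mn j : measurable_fun setT (fun w => (negpart (V j w))%:E).
  exact/measurable_EFinP.
have mab j : measurable_fun setT (fun w => `|V j w|%R) by exact: measurableT_comp.
apply/integrableP; split; first exact/measurable_EFinP.
apply: (@le_lt_trans _ _ ((B + (C + C)) + B)); last first.
  apply: lte_add_pinfty => //; apply: lte_add_pinfty => //.
  exact: lte_add_pinfty.
apply: (@integral_split k.+1 (fun w => `|V k.+1 w|%R)) => //; last first.
  have -> : \int[P]_(w in [set w | jump_time rho k.+1 w = +oo]) `|V k.+1 w|%:E
          = \int[P]_(w in [set w | jump_time rho k.+1 w = +oo]) `|V k w|%:E.
    by apply: eq_integral => w; rewrite inE/= => /V_pinfty ->.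
  by apply: ge0_subset_integral => //; exact/measurable_EFinP.
move=> n.
have [_ + +] := integral_step (@F_E k n) (fun w => id).
have -> : E k n `&` E k.+1 n = E k.+1 n.
  apply/setIidr => w; apply: le_trans; apply: jump_time_le => //; exact: srho.
move=> iVS eV.
have iN : P.-integrable (E k.+1 n) (fun w => (negpart (V k.+1 w))%:E).
  apply: (le_integrable _ _ _ iVS) => //; first exact: measurable_funTS.
  move=> w _ /=; rewrite lee_fin ger0_norm// /negpart ge_max normr_ge0 andbT.
  by rewrite -normrN ler_norm.
have -> : \int[P]_(w in E k.+1 n) `|V k.+1 w|%:E =
    \int[P]_(w in E k.+1 n) ((V k.+1 w)%:E +
      ((negpart (V k.+1 w))%:E + (negpart (V k.+1 w))%:E)).
  apply: eq_integral => w _; rewrite -!EFinD /negpart; congr (_%:E).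
  have [V0|V0] := ltP (V k.+1 w) 0%R.
    by rewrite ltr0_norm// max_l; lra.
  by rewrite ger0_norm// max_r; lra.
rewrite integralD//; last exact: integrableD.
rewrite integralD// -eV.
have leC : \int[P]_(w in E k.+1 n) (negpart (V k.+1 w))%:E <= C.
  by apply: ge0_subset_integral => // w _; rewrite lee_fin.
apply: leeD; last exact: leeD.
apply: (@le_trans _ _ (\int[P]_(w in E k.+1 n) `|V k w|%:E)); last first.
  by apply: ge0_subset_integral => //; exact/measurable_EFinP.
have iVE : P.-integrable (E k.+1 n) (EFin \o V k) by exact: integrableS iV.
apply: le_integral => //; first exact: (integrable_abse iVE).
by move=> w _; rewrite lee_fin ler_norm.
Qed.

(** The condition on [rho N] makes [V N] the terminal value, so the bound at [+oo] starts the
    backward induction. *)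
Lemma jump_local_martingale_UI : (forall w, rho N w = +oo) ->
  \int[P]_w (negpart (jump_sum N rho J +oo w))%:E < +oo ->
  UI_martingale F P M.
Proof.
move=> rhoN fin.
have VN w : V N w = jump_sum N rho J +oo w.
  apply/esym/jump_sum_between; [exact: srho|exact: rho_nd|exact: leey|].
  by right; exact: rhoN.
(* Descending induction on the index [N - i]; for [i >= N] truncated subtraction keeps it at 0. *)
have negV i : \int[P]_w (negpart (V (N - i) w))%:E < +oo.
  elim: i => [|i IH].
    by rewrite subn0; under eq_integral do rewrite VN.
  have [iN|Ni] := ltnP i N; last first.
    by have := IH; rewrite subnS (eqP (_ : (N - i)%N == 0%N)).
  by apply: integral_negpart_backward; rewrite subnSK.
have stopped_min n t w : (0 <= t)%R ->
    stopped M (tau n) t w = jump_sum N rho J (mine t%:E (tau n w)) w.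
  move=> t0; rewrite /stopped M_fine//.
    by rewrite le_min lee_fin t0 (stau n).1.
  by rewrite gt_min ltry.
have iV k : (k <= N)%N -> P.-integrable setT (EFin \o V k).
  elim: k => [_|k IH kN].
    (* Stopping has no effect at time 0, so [V 0] is the initial value of a martingale. *)
    have [_ iY _] := mtau 0; apply: eq_integrable (iY 0%R (lexx _)) => // w _.
    by rewrite /= stopped_min// min_l// (stau 0).1.
  apply: integrable_forward; first exact/IH/ltnW.
  by have := negV (N - k.+1)%N; rewrite subKn.
pose G w : R := (\sum_(k < N.+1) `|V k w|)%R.
have iG : P.-integrable setT (EFin \o G).
  rewrite (_ : _ \o _ = fun w => \sum_(k < N.+1) `|(EFin \o V k) w|); last first.
    by apply/funext => w; rewrite /= -sumEFin.
  apply: integrable_sum => // k _; apply: integrable_abse; apply: iV.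
  by rewrite -ltnS.
have G0 w : (0 <= G w)%R by exact: sumr_ge0.
have XG r w : 0 <= r -> (`|jump_sum N rho J r w| <= G w)%R.
  move=> r0.
  have rN : r < jump_time rho N.+1 w \/ jump_time rho N.+1 w = +oo.
    by right; exact: rhoN.
  have [j jN ->] := jump_sum_jump_time N J srho rho_nd rN r0.
  by rewrite /G (bigD1 (Ordinal jN))//= lerDl sumr_ge0.
have aM : adapted F M.
  move=> t t0; have -> : M t = fun w => jump_sum N rho J (mine t%:E (cst +oo w)) w.
    by apply/funext => w; rewrite /= min_l ?leey// ME.
  by apply: jump_sum_stopped_measurable => //; exact: stopping_time_pinfty.
have mM t : (0 <= t)%R -> measurable_fun setT (M t).
  move=> t0 _ B mB; rewrite setTI; have [_ sub _] := hF.
  by apply: (sub t) => //; exact: aM.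
have MG t w : (0 <= t)%R -> (`|M t w| <= G w)%R by move=> t0; rewrite ME// XG.
(* For each [w] the stopped value is [M t w] once [tau n w >= t]; domination by [G] then carries the
   martingale identity to the limit. *)
have cvgM t A : (0 <= t)%R -> measurable A ->
    \int[P]_(w in A) (stopped M (tau n) t w)%:E @[n --> \oo] -->
    \int[P]_(w in A) (M t w)%:E.
  move=> t0 mA.
  apply: (@dominated_cvg _ _ _ _ _ mA _ _ (EFin \o G)) => //.
  - move=> n; have [_ iY _] := mtau n.
    by case/integrableP: (iY t t0) => mY _; exact: measurable_funTS.
  - move=> w _; apply: cvg_near_cst; near=> n.
    rewrite stopped_min// ME// min_l//.
    by near: n; have := @tau_cvg w; move=> /cvgeyPge/(_ t).
  - exact: integrableS iG.
  - by move=> n w _; rewrite stopped_min// lee_fin XG// le_min lee_fin t0 (stau n).1.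
have mgM : martingale F P M.
  split=> //.
    move=> t t0; apply: (le_integrable measurableT _ _ iG).
      by apply/measurable_EFinP; exact: mM.
    by move=> w _; rewrite /= lee_fin (ger0_norm (G0 w)) MG.
  move=> s t A s0 st FA; have t0 := le_trans s0 st.
  have mA : measurable A by have [_ sub _] := hF; exact: (sub s).
  apply: (@cvg_unique _ _ (\int[P]_(w in A) (stopped M (tau n) t w)%:E @[n --> \oo])) => //.
    exact: cvgM.
  have -> : (fun n => \int[P]_(w in A) (stopped M (tau n) t w)%:E) =
            (fun n => \int[P]_(w in A) (stopped M (tau n) s w)%:E).
    by apply/funext => n; have [_ _ mg] := mtau n; exact: mg.
  exact: cvgM.
split=> // e e0.
have mG : measurable_fun setT G by apply/measurable_EFinP; case/integrableP: iG.
(* All events [{|M t| > k}] lie in [{G > k}], so one level [k] at which the tail of [G] is small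
   serves every [t]. *)
pose D (k : nat) : set Omega := [set w | (k%:R < G w)%R].
have mlt (f : Omega -> R) (x : R) : measurable_fun setT f ->
    measurable [set w | (x < f w)%R].
  move=> mf; have := mf measurableT `]x, +oo[%classic (measurable_itv _).
  rewrite setTI; congr measurable; apply/seteqP.
  by split=> w /=; rewrite in_itv/= andbT.
have mD k : measurable (D k) by exact: mlt.
have cvgG : \int[P]_(w in D k) (G w)%:E @[k --> \oo] --> \int[P]_(w in [set: Omega]) 0.
  under eq_fun do rewrite integral_mkcond.
  apply: (@dominated_cvg _ _ _ _ _ measurableT _ _ (EFin \o G)) => //.
  - move=> k; apply/(measurable_restrictT _ _).1 => //.
    by apply: measurable_funTS; exact/measurable_EFinP.
  - move=> w _; apply: cvg_near_cst; near=> k.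
    rewrite patchE memNset// /D/=; apply/negP; rewrite -leNgt.
    apply: (le_trans (ltW (truncnS_gt (G w)))); rewrite ler_nat.
    by near: k; exact: nbhs_infty_ge.
  - by move=> k w _; rewrite patchE; case: ifP => _; rewrite ?abse0 /= lee_fin ?ger0_norm.
rewrite integral0 in cvgG.
have [k _ hk] : \forall k \near \oo, \int[P]_(w in D k) (G w)%:E < e%:E.
  have nb : nbhs (0 : \bar R) [set x | x < e%:E].
    by apply: open_nbhs_nbhs; split; [exact: open_ereal_lt_ereal|rewrite /= lte_fin].
  exact: cvgG nb.
exists k%:R%R => t t0; apply: le_lt_trans (hk k (leqnn k)).
have mT : measurable [set w | (k%:R < `|M t w|)%R].
  by apply: mlt; apply: measurableT_comp => //; exact: mM.
apply: (@le_trans _ _ (\int[P]_(w in [set w | (k%:R < `|M t w|)%R]) (G w)%:E)).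
  apply: ge0_le_integral => //.
  - apply/measurable_EFinP; apply: measurableT_comp => //.
    by apply: measurable_funTS; exact: mM.
  - by apply/measurable_EFinP; exact: measurable_funTS.
  - by move=> w _; rewrite lee_fin MG.
apply: ge0_subset_integral => //.
- by apply/measurable_EFinP; exact: measurable_funTS.
- by move=> w _; rewrite lee_fin.
- by move=> w /= h; exact: lt_le_trans h (MG _ _ t0).
Unshelve. all: by end_near. Qed.

End JumpLocalMartingale.

(** * Reduction of the finite family of jumps to an infinite sequence *)

Theorem theorem1p1 (d : measure_display) (Omega : measurableType d)
  (R : realType) (P : probability Omega R) (F : R -> set (set Omega))
  (N : nat) (rho : 'I_N -> Omega -> \bar R) (J : 'I_N -> Omega -> R)
  (M : R -> Omega -> R) :
  filtration F ->
  (forall m, stopping_time F (rho m)) ->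
  (forall (i j : 'I_N) w, (i <= j)%N -> rho i w <= rho j w) ->
  (forall m, measurable_wrt (F_at F (rho m)) (J m)) ->
  (forall t w, (0 <= t)%R ->
     M t w = (\sum_(m < N) J m w * ((rho m w <= t%:E)%E : bool)%:R)%R) ->
  local_martingale F P M ->
  \int[P]_w liminf_pinfty (fun t => (negpart (M t w))%:E) < +oo ->
  UI_martingale F P M.
Proof.
move=> hF srho rho_nd mJ ME [tau [stau tau_nd tau_cvg mtau]] fin.
(* Padding with jumps of size 0 at time [+oo] keeps the times nondecreasing and gives
   [rho' N = +oo]. *)
pose rho' k w : \bar R := if insub k is Some m then rho m w else +oo.
pose J' k w : R := if insub k is Some m then J m w else 0%R.
have rho'E (m : 'I_N) : rho' m = rho m by apply/funext => w; rewrite /rho' valK.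
have J'E (m : 'I_N) : J' m = J m by apply/funext => w; rewrite /J' valK.
have rho'out k : (N <= k)%N -> rho' k = cst +oo.
  by move=> Nk; apply/funext => w; rewrite /rho' insubN// -leqNgt.
have J'out k : (N <= k)%N -> J' k = cst 0%R.
  by move=> Nk; apply/funext => w; rewrite /J' insubN// -leqNgt.
have srho' k : stopping_time F (rho' k).
  have [kN|Nk] := ltnP k N; first by rewrite (rho'E (Ordinal kN)).
  by rewrite rho'out//; exact: stopping_time_pinfty.
have rho'_nd k w : rho' k w <= rho' k.+1 w.
  have [kN|Nk] := ltnP k.+1 N; last by rewrite (rho'out k.+1)//; exact: leey.
  rewrite (rho'E (Ordinal kN)) (rho'E (Ordinal (ltnW kN))).
  exact: rho_nd.
have mJ' k : measurable_wrt (F_at F (rho' k)) (J' k).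
  have [kN|Nk] := ltnP k N.
    by rewrite (rho'E (Ordinal kN)) (J'E (Ordinal kN)).
  rewrite J'out// rho'out// => B mB.
  have mC : measurable (cst 0%R @^-1` B : set Omega).
    by rewrite -[X in measurable X]setTI; exact: measurable_cst.
  split=> // t t0; have [_ st] := stopping_time_pinfty hF.
  rewrite (_ : _ `&` _ = [set w | cst +oo w <= t%:E]); first exact: st.
  by apply/seteqP; split=> w /=; [case|rewrite leye_eq].
have ME' t w : (0 <= t)%R -> M t w = jump_sum N rho' J' t%:E w.
  (* At a finite [t], [rho m w <= t] forces [rho m w < +oo], so the extra factor in [jump_sum]
     changes nothing. *)
  move=> t0; rewrite ME//; apply: eq_bigr => m _; rewrite rho'E J'E.
  congr (_ * (nat_of_bool _)%:R)%R; case: (leP (rho m w) t%:E) => //= h.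
  by rewrite (le_lt_trans h (ltry _)).
apply: (jump_local_martingale_UI hF srho' rho'_nd mJ' ME' stau tau_nd tau_cvg).
- by move=> n; case: (mtau n).
- by move=> w; rewrite rho'out.
- under eq_integral do rewrite -(liminf_negpart_jump_sum srho' (fun t t0 => ME' t _ t0)).
  exact: fin.
Qed.
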